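(* Let $\mathbf{S}$ be a finite monoid. Suppose there exist positive integers $p,q$ such that $\mathbf{S}$ satisfies the following: (i) for any even $m,n\in\mathbb{N}$, $\mathbf{S}\models\mathcal{M}_{n,p,q}\odot\overline{\mathcal{M}_{m,p,q}}\approx\overline{\mathcal{M}_{m,p,q}}\odot\mathcal{M}_{n,p,q}$; (ii) $\mathbf{S}\models\mathscr{A}_{\alpha,\beta}$ for some $\alpha,\beta\in\mathbb{N}$ with $\alpha\le 2p+2q$; (iii) $x^py^px^qy^q$ is an isoterm for $\mathbf{S}$; (iv) $\{x^py^{p+q}x^q,\ y^px^{p+q}y^q\}$ is an island for $\mathbf{S}$. Then $\mathbf{S}$ is non-finitely related.
   Context: $\mathbb{N}=\{1,2,3,\dots\}$. An operation $f:A^n\to A$ preserves a relation $R\subseteq A^k$ if $f(r_1,\dots,r_n)\in R$ for all $r_1,\dots,r_n\in R$, with $f$ applied coordinatewise. An algebra $\mathbf{A}$ with universe $A$ is finitely related if there is a finite set of finitary relations on $A$ such that the finitary operations on $A$ preserving all of those relations are precisely the term functions of $\mathbf{A}$; otherwise it is non-finitely related. Monoids are regarded as algebras with a single binary operation; the $n$-ary term functions are those induced by words in $n$ variables. For $n,p,q\in\mathbb{N}$ with $n$ even, the maelstrom word on $n$ variables is $$\mathcal{M}_{n,p,q}=x_1^p\cdot\Bigl(\prod_{k=1}^{\frac n2-1}x_{2k+1}^px_{2k}^p\Bigr)\cdot x_n^p\cdot\Bigl(\prod_{k=0}^{\frac n2-1}x_{n-(2k+1)}^qx_{n-2k}^q\Bigr),$$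 where products are taken in increasing order of $k$ (e.g. $\mathcal{M}_{4,p,q}=x_1^px_3^px_2^px_4^px_3^qx_4^qx_1^qx_2^q$). $\overline{\mathcal{M}_{m,p,q}}$ denotes the maelstrom word over a disjoint set of variables $y_1,\dots,y_m$. For a word $\mathbf{w}$, $\mathcal{M}_{n,p,q}\odot\mathbf{w}$ is the word obtained by inserting $\mathbf{w}$ into $\mathcal{M}_{n,p,q}$ immediately after the initial part consisting of all blocks $x_i^p$ and immediately before the final part consisting of all blocks $x_i^q$, i.e. $$\mathcal{M}_{n,p,q}\odot\mathbf{w}=x_1^p\Bigl(\prod_{k=1}^{\frac n2-1}x_{2k+1}^px_{2k}^p\Bigr)x_n^p\cdot\mathbf{w}\cdot\prod_{k=0}^{\frac n2-1}x_{n-(2k+1)}^qx_{n-2k}^q;$$ similarly for $\overline{\mathcal{M}_{m,p,q}}\odot\mathbf{w}$. $\mathscr{A}_{\alpha,\beta}$ is the set of identities $\{x^\alpha\approx x^{\alpha+\beta},\ t_1xt_2x\cdots t_\alpha x\approx x^\alpha t_1t_2\cdots t_\alpha\}$. A word $\mathbf{w}$ is an isoterm for $\mathbf{S}$ if, for every word $\mathbf{u}$, $\mathbf{S}\models\mathbf{u}\approx\mathbf{w}$ implies $\mathbf{u}=\mathbf{w}$. A set of words $\{\mathbf{u}_1,\dots,\mathbf{u}_r\}$ is an island for $\mathbf{S}$ if $\mathbf{S}\models\mathbf{u}_i\approx\mathbf{u}_j$ for all $i,j$, and for every word $\mathbf{v}$ and every $i$, $\mathbf{S}\models\mathbf{u}_i\approx\mathbf{v}$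 if and only if $\mathbf{v}=\mathbf{u}_k$ for some $k$. *)

(* Defs.v *)
From HB Require Import structures.
From mathcomp Require Import all_boot.

Set Implicit Arguments.
Unset Strict Implicit.
Unset Printing Implicit Defensive.

#[short(type="finMonoidType")]
HB.structure Definition FinMonoid := {S of monoid.Monoid S & Finite S}.

(** * Finitely related algebras *)

Definition preserves (A : finType) (n k : nat) (f : n.-tuple A -> A)
    (R : {set k.-tuple A}) : Prop :=
  forall r : 'I_n -> k.-tuple A, (forall i, r i \in R) ->
    [tuple f [tuple tnth (r i) j | i < n] | j < k] \in R.

(* [C n] is the set of n-ary term functions of an algebra with universe A.
   Operations and relations have positive arity, and the finite set of
   relations is given as a finite family. *)
Definition finitely_related (A : finType)
    (C : forall n, (n.-tuple A -> A) -> Prop) : Prop :=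
  exists (r : nat) (k : 'I_r -> nat) (R : forall i, {set (k i).-tuple A}),
    (forall i, 0 < k i) /\
    forall n (f : n.-tuple A -> A), 0 < n ->
      ((forall i, preserves f (R i)) <-> C n f).

(** * Words and identities *)

Definition word_eval (S : monoidType) (X : Type) (s : X -> S) (w : seq X) : S :=
  (\prod_(x <- w) s x)%g.

(* The signature is a single binary operation, so the words inducing term
   functions are nonempty. *)
Definition monoid_term_function (S : monoidType) (n : nat)
    (f : n.-tuple S -> S) : Prop :=
  exists w : seq 'I_n, w <> [::] /\ forall a, f a = word_eval (tnth a) w.

Definition monoid_finitely_related (S : finMonoidType) : Prop :=
  finitely_related (@monoid_term_function S).

(* A countably infinite alphabet containing the pairwise distinct letters
   x_i, y_i, t_i. *)
Definition letter : Type := (nat * nat)%type.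
Definition X (i : nat) : letter := (0, i).
Definition Y (i : nat) : letter := (1, i).
Definition T (i : nat) : letter := (2, i).

Definition word := seq letter.

Definition satisfies (S : monoidType) (u v : word) : Prop :=
  forall s : letter -> S, word_eval s u = word_eval s v.

(* Words over the signature are nonempty; [seq letter] also contains the empty
   word, which is excluded explicitly where a word is quantified over. *)
Definition isoterm (S : monoidType) (w : word) : Prop :=
  forall u : word, u <> [::] -> satisfies S u w -> u = w.

Definition island (S : monoidType) (U : seq word) : Prop :=
  {in U &, forall u v, satisfies S u v} /\
  forall v : word, v <> [::] ->
    {in U, forall u, satisfies S u v <-> v \in U}.

(** * Maelstrom words *)

(* [z 1], ..., [z n] are the variables; [nseq p (z i)] is the block z_i^p. *)
Definition maelstrom_init (z : nat -> letter) (n p : nat) : word :=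
  nseq p (z 1)
  ++ \big[cat/[::]]_(1 <= k < n./2) (nseq p (z (2 * k + 1)) ++ nseq p (z (2 * k)))
  ++ nseq p (z n).

Definition maelstrom_final (z : nat -> letter) (n q : nat) : word :=
  \big[cat/[::]]_(0 <= k < n./2)
    (nseq q (z (n - (2 * k + 1))) ++ nseq q (z (n - 2 * k))).

Definition maelstrom (z : nat -> letter) (n p q : nat) : word :=
  maelstrom_init z n p ++ maelstrom_final z n q.

(* The word M_{n,p,q} (.) w. *)
Definition maelstrom_insert (z : nat -> letter) (n p q : nat) (w : word) : word :=
  maelstrom_init z n p ++ w ++ maelstrom_final z n q.

(** * The identities A_{alpha,beta} *)

Definition satisfies_A (S : monoidType) (alpha beta : nat) : Prop :=
  let x := X 1 in
  satisfies S (nseq alpha x) (nseq (alpha + beta) x) /\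
  satisfies S (\big[cat/[::]]_(1 <= i < alpha.+1) [:: T i; x])
              (nseq alpha x ++ [seq T i | i <- iota 1 alpha]).

(* Main.v *)
Require Import Defs.
From mathcomp Require Import all_boot.
From mathcomp Require Import zify.

(** A finitely related algebra has a bound [b] such that an operation of arity
    greater than [b] is a term function as soon as it agrees with a term
    function whenever two given arguments coincide: among more than [#|R|]
    tuples of a relation [R], two are equal. It therefore suffices to find, for
    arbitrarily large arities [N], an operation which is not a term function
    although it coincides with one on each set of tuples with two given equal
    entries ([cycle_op], [cycle_op_preserves], [cycle_op_not_term]).

    In a maelstrom word consecutive letters cross (x^p y^p x^q y^q) and any
    other two letters are nested (x^p y^p y^q x^q), the earlier one outside.
    Put [N] letters on a cycle, [N] even. Cutting the cycle somewhere gives a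
    path and hence a maelstrom word; the operation evaluates the word obtained
    by cutting next to a letter whose value is repeated in the tuple of
    arguments. Two choices of the cut give the same value
    ([cut_mael_repeat]): a repeated letter has at least 2p + 2q >= alpha
    occurrences, so the identities in A move it to the front, and the rest of
    the word is evaluated as if it were erased. If for each of the two cuts a
    letter next to it is erased, each word becomes a nesting of the maelstrom
    words of the two arcs between the cuts, one in either order, and these are
    equal by the commutation law for maelstrom words ([mael_rotate]).

    Suppose that a word w induced this operation. Its restriction to two letters
    is forced: by the isoterm hypothesis neighbours on the cycle cross as in the
    maelstrom words, and by the island hypothesis any other two letters are
    nested, in one of the two possible ways ([crossing_order],
    [nesting_order]). But if two neighbours are both nested with a third letter,
    then either both are outside it or both are inside it. These choices
    propagate around the cycle, where they cannot be consistent
    ([no_cyclic_nesting]). *)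

Set Implicit Arguments.
Unset Strict Implicit.
Unset Printing Implicit Defensive.

(** * Maelstrom words as functions of the list of their variables *)

(** Read without exponents, the final part of the maelstrom word on x_1, x_2,
    ... is the reversal of x_2 x_1 x_4 x_3 ..., while its initial part is
    x_1 x_3 x_2 x_5 x_4 ...: both swap the consecutive pairs of the list of
    variables, one from position 1 and the other from position 2. Hence x_i and
    x_(i+1) cross (they occur in the same order in both parts), and any two
    other letters are nested. *)
Fixpoint swap_pairs (L : Type) (s : seq L) : seq L :=
  if s is x :: y :: t then y :: x :: swap_pairs t else s.

Definition swap_pairs_behead (L : Type) (s : seq L) : seq L :=
  if s is x :: t then x :: swap_pairs t else [::].

Definition blocks (L : Type) (k : nat) (s : seq L) : seq L :=
  flatten [seq nseq k x | x <- s].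

Definition mael_init (L : Type) (p : nat) (s : seq L) : seq L :=
  blocks p (swap_pairs_behead s).

Definition mael_final (L : Type) (q : nat) (s : seq L) : seq L :=
  blocks q (rev (swap_pairs s)).

Definition mael (L : Type) (p q : nat) (s : seq L) : seq L :=
  mael_init p s ++ mael_final q s.

Lemma pair_ind (L : Type) (P : seq L -> Prop) :
  P [::] -> (forall x, P [:: x]) ->
  (forall x y s, P s -> P (x :: y :: s)) -> forall s, P s.
Proof.
move=> P0 P1 P2 s; suff [] : P s /\ forall x, P (x :: s) by [].
by elim: s => [|y s [IHs IHx]]; split=> // x; apply: P2.
Qed.

Lemma swap_pairs_cat (L : Type) (s t : seq L) :
  ~~ odd (size s) -> swap_pairs (s ++ t) = swap_pairs s ++ swap_pairs t.
Proof.
by elim/pair_ind: s => // x y s IHs /=; rewrite negbK => /IHs ->.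
Qed.

Lemma swap_pairs_map (L M : Type) (f : L -> M) (s : seq L) :
  swap_pairs (map f s) = map f (swap_pairs s).
Proof. by elim/pair_ind: s => //= x y s ->. Qed.

Lemma swap_pairs_behead_map (L M : Type) (f : L -> M) (s : seq L) :
  swap_pairs_behead (map f s) = map f (swap_pairs_behead s).
Proof. by case: s => //= x s; rewrite swap_pairs_map. Qed.

Lemma perm_swap_pairs (L : eqType) (s : seq L) : perm_eq (swap_pairs s) s.
Proof.
elim/pair_ind: s => // x y s IHs /=; rewrite (perm_catCA [:: y] [:: x]) /=.
by rewrite !perm_cons.
Qed.

Lemma perm_swap_pairs_behead (L : eqType) (s : seq L) :
  perm_eq (swap_pairs_behead s) s.
Proof. by case: s => //= x s; rewrite perm_cons perm_swap_pairs. Qed.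

Lemma blocks1 (L : Type) k (x : L) : blocks k [:: x] = nseq k x.
Proof. exact: cats0. Qed.

Lemma blocks_cat (L : Type) k (s t : seq L) :
  blocks k (s ++ t) = blocks k s ++ blocks k t.
Proof. by rewrite /blocks map_cat flatten_cat. Qed.

Lemma blocks_map (L M : Type) (f : L -> M) k (s : seq L) :
  blocks k (map f s) = map f (blocks k s).
Proof.
by elim: s => //= x s; rewrite /blocks /= => ->; rewrite map_cat map_nseq.
Qed.

Lemma filter_blocks (L : Type) (a : pred L) k (s : seq L) :
  filter a (blocks k s) = blocks k (filter a s).
Proof.
elim: s => // x s IHs; rewrite -cat1s blocks_cat blocks1 !filter_cat blocks_cat.
by rewrite IHs filter_nseq /=; case: (a x); rewrite ?mul1n ?blocks1.
Qed.

Lemma count_blocks (L : Type) (a : pred L) k (s : seq L) :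
  count a (blocks k s) = k * count a s.
Proof.
elim: s => [|x s IHs]; first by rewrite muln0.
by rewrite -cat1s blocks_cat blocks1 !count_cat IHs count_nseq /= addn0; lia.
Qed.

Lemma mael_init_map (L M : Type) (f : L -> M) p (s : seq L) :
  mael_init p (map f s) = map f (mael_init p s).
Proof. by rewrite /mael_init swap_pairs_behead_map blocks_map. Qed.

Lemma mael_final_map (L M : Type) (f : L -> M) q (s : seq L) :
  mael_final q (map f s) = map f (mael_final q s).
Proof. by rewrite /mael_final swap_pairs_map -map_rev blocks_map. Qed.

Lemma mael_map (L M : Type) (f : L -> M) p q (s : seq L) :
  mael p q (map f s) = map f (mael p q s).
Proof. by rewrite /mael mael_init_map mael_final_map map_cat. Qed.

Lemma count_mael (L : eqType) (a : pred L) p q (s : seq L) :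
  count a (mael p q s) = (p + q) * count a s.
Proof.
rewrite count_cat !count_blocks count_rev mulnDl.
by rewrite (permP (perm_swap_pairs s)) (permP (perm_swap_pairs_behead s)).
Qed.

Lemma maelstrom_initE (z : nat -> letter) (h p : nat) :
  maelstrom_init z h.+1.*2 p = mael_init p [seq z i | i <- iota 1 h.+1.*2].
Proof.
rewrite /maelstrom_init doubleK.
have -> : forall h, \big[cat/[::]]_(1 <= k < h.+1)
    (nseq p (z (2 * k + 1)) ++ nseq p (z (2 * k))) =
  blocks p (swap_pairs [seq z i | i <- iota 2 h.*2]).
  elim=> [|{}h IHh]; first by rewrite big_geq.
  rewrite doubleS -(addn2 h.*2) iotaD map_cat big_nat_recr //= IHh.
  rewrite swap_pairs_cat ?size_map ?size_iota ?odd_double // blocks_cat.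
  congr (_ ++ _); rewrite /= /blocks /= cats0.
  by congr (nseq p (z _) ++ nseq p (z _)); lia.
rewrite -!blocks1 -!blocks_cat /mael_init; congr blocks.
rewrite doubleS -(addn1 h.*2.+1) iotaD map_cat /= swap_pairs_cat.
  by rewrite /= add1n addn1.
by rewrite size_map size_iota odd_double.
Qed.

Lemma maelstrom_finalE (z : nat -> letter) (h q : nat) :
  maelstrom_final z h.*2 q = mael_final q [seq z i | i <- iota 1 h.*2].
Proof.
rewrite /maelstrom_final doubleK /mael_final.
elim: h => [|h IHh]; first by rewrite big_geq.
rewrite big_nat_recl // doubleS -(addn2 h.*2) iotaD map_cat.
rewrite swap_pairs_cat ?size_map ?size_iota ?odd_double // rev_cat blocks_cat.
rewrite -IHh /=; congr (_ ++ _).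
  by rewrite /blocks /= cats0; congr (nseq q (z _) ++ nseq q (z _)); lia.
apply: eq_bigr => k _.
by congr (nseq q (z _) ++ nseq q (z _)); lia.
Qed.

(** * Evaluation of words in a monoid *)

Section Evaluation.

Variable S : monoidType.
Local Open Scope group_scope.

Lemma word_eval_cat (L : Type) (v : L -> S) (s t : seq L) :
  word_eval v (s ++ t) = word_eval v s * word_eval v t.
Proof. exact: big_cat. Qed.

Lemma word_eval_map (L M : Type) (v : M -> S) (f : L -> M) (s : seq L) :
  word_eval v (map f s) = word_eval (v \o f) s.
Proof. exact: big_map. Qed.

Lemma word_eval_filter (L : Type) (v : L -> S) (a : pred L) (s : seq L) :
  word_eval v (filter a s) = word_eval (fun x => if a x then v x else 1) s.
Proof. by rewrite /word_eval big_filter big_mkcond. Qed.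

Lemma word_eval_nseq (L : Type) (v : L -> S) k (x : L) :
  word_eval v (nseq k x) = v x ^+ k.
Proof.
by elim: k => [|k IHk]; rewrite /word_eval /= ?big_nil // big_cons expgS -IHk.
Qed.

Lemma word_eval_blocks (L : Type) (v : L -> S) k (s : seq L) :
  word_eval v (blocks k s) = \prod_(x <- s) v x ^+ k.
Proof.
rewrite /word_eval /blocks big_flatten big_map.
by apply: eq_bigr => x _; rewrite -word_eval_nseq.
Qed.

(** Splitting the list at an even position separates the two parts of the word
    except for one crossing, that of the letters next to the split. As soon as
    these have commuting values, for instance when one of them is erased, the
    word is a nesting of two smaller maelstrom words. *)
Lemma mael_cat_eval (L : Type) (x0 : L) (v : L -> S) p q (s t : seq L) :
  ~~ odd (size s) -> commute (v (last x0 s)) (v (head x0 t)) ->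
  word_eval v (mael p q (s ++ t)) =
  word_eval v (mael_init p s ++ mael p q t ++ mael_final q s).
Proof.
move=> ev vC; rewrite /mael /mael_final swap_pairs_cat // rev_cat blocks_cat.
rewrite -!catA !(word_eval_cat _ (mael_init _ _)) mulgA.
congr (_ * _); rewrite -word_eval_cat /mael_init -blocks_cat !word_eval_blocks.
case: s ev vC => //= x s ev vC.
case: t vC => [|y t]; first by rewrite /= !cats0.
case/lastP: s ev => // s z; rewrite size_rcons negbK last_rcons /= => ev vC.
rewrite cat_rcons swap_pairs_cat // -cats1 swap_pairs_cat //=.
rewrite !big_cons !big_cat /= !big_cons !big_nil !mulgA; congr (_ * _).
by rewrite mulg1 -!mulgA (commuteX2 _ _ vC).
Qed.

(** The identity t_1 x t_2 x ... t_n x = x^n t_1 ... t_n at the element x. *)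
Definition gathers (x : S) (n : nat) : Prop :=
  forall ts : seq S, size ts = n ->
    \prod_(t <- ts) (t * x) = x ^+ n * \prod_(t <- ts) t.

(** With all t_i but the last equal to 1, the identity reads
    x^(m-1) t x = x^m t; this absorbs each further occurrence of x into the
    power already gathered in front. *)
Lemma gathers_leq (x : S) (m n : nat) :
  0 < m -> m <= n -> gathers x m -> gathers x n.
Proof.
case: m => // m _ le_mn gx; have mov v : x ^+ m * (v * x) = x ^+ m.+1 * v.
  have := gx (rcons (nseq m 1) v); rewrite size_rcons size_nseq => /(_ erefl).
  by rewrite -cats1 !big_cat !big_seq1 /= !big_nseq !iter_mulg_1 expg1n !mul1g.
elim: n le_mn => // n IHn; rewrite leq_eqVlt => /predU1P [<- // | lt_mn] ts.
case/lastP: ts => // ts v; rewrite size_rcons => -[szts].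
rewrite -cats1 !big_cat !big_seq1 /= (IHn lt_mn _ szts) !mulgA.
set w := \prod_(t <- ts) t.
have [k ->] : exists k, n = k + m by exists (n - m); rewrite subnK // ltnW.
rewrite -addnS !expgnDr -!mulgA; congr (_ * _).
by rewrite (mulgA w) mov !mulgA.
Qed.

(** When the letters in [a] share a value and are numerous enough, their
    occurrences move to the front, so that the other letters may be evaluated as
    if those in [a] were erased. *)
Lemma gathers_eval (L : Type) (v : L -> S) (a : pred L) (c : S) (w : seq L) :
  (forall x, a x -> v x = c) -> gathers c (count a w) ->
  word_eval v w = c ^+ count a w * word_eval v (filter (predC a) w).
Proof.
move=> va gc; suff [ts [r [szts -> ->]]] : exists (ts : seq S) (r : S),
    [/\ size ts = count a w, word_eval v w = (\prod_(t <- ts) (t * c)) * r &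
       word_eval v (filter (predC a) w) = (\prod_(t <- ts) t) * r].
  by rewrite gc // mulgA.
elim/last_ind: w {gc} => [|w x [ts [r [szts wE fE]]]].
  by exists [::], 1; rewrite /word_eval !big_nil mulg1.
rewrite -cats1 count_cat filter_cat !word_eval_cat wE fE -szts /=.
case: ifPn => [ax|]; last first.
  rewrite negbK => ax; exists (rcons ts r), 1.
  rewrite size_rcons ax addn1 -cats1 !big_cat !big_seq1 /word_eval big_seq1.
  by rewrite big_nil va // !mulg1 -!mulgA.
exists ts, (r * v x); rewrite /word_eval big_seq1 !mulgA; split=> //.
by rewrite (negbTE ax) !addn0.
Qed.

Lemma satisfies_A_gathers (alpha beta : nat) :
  satisfies_A S alpha beta -> forall c : S, gathers c alpha.
Proof.
move=> [_ A2] c ts szts.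
have := A2 (fun l => if l.1 == 2 then ts`_(l.2 - 1) else c).
rewrite word_eval_cat word_eval_nseq /= word_eval_map.
have -> : forall n, word_eval (fun l : letter => if l.1 == 2 then ts`_(l.2 - 1) else c)
   (\big[cat/[::]]_(1 <= i < n.+1) [:: T i; X 1]) =
   \prod_(0 <= i < n) (ts`_i * c).
  elim=> [|n IHn]; first by rewrite /word_eval !(big_geq, big_nil).
  rewrite [in RHS]big_nat_recr // [in LHS]big_nat_recr //= word_eval_cat.
  by rewrite IHn /word_eval big_cons big_seq1 /= subn1.
move=> eqA; rewrite !(big_nth 1) szts {}eqA; congr (_ * _).
rewrite /word_eval /index_iota subn0 (iotaDl 1 0) big_map.
by apply: eq_bigr => i _; rewrite /= subSS subn0.
Qed.

Section Rotation.

Variables p q : nat.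
Hypothesis maelstrom_comm : forall m n : nat,
  0 < m -> 0 < n -> ~~ odd m -> ~~ odd n ->
  satisfies S (maelstrom_insert X n p q (maelstrom Y m p q))
              (maelstrom_insert Y m p q (maelstrom X n p q)).

(** This is the assumed commutation law, read on lists of values. *)
Lemma mael_nest_comm (s t : seq S) :
  s != [::] -> t != [::] -> ~~ odd (size s) -> ~~ odd (size t) ->
  word_eval id (mael_init p s ++ mael p q t ++ mael_final q s) =
  word_eval id (mael_init p t ++ mael p q s ++ mael_final q t).
Proof.
rewrite -!size_eq0 -!lt0n => s_gt0 t_gt0 evs evt.
pose v (l : letter) := if l.1 == 0 then s`_(l.2 - 1) else t`_(l.2 - 1).
have := maelstrom_comm t_gt0 s_gt0 evt evs v.
have vals z r : (forall i, v (z i) = r`_(i - 1)) ->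
    [seq v l | l <- [seq z i | i <- iota 1 (size r)]] = r.
  move=> vz; apply: (@eq_from_nth _ 1); rewrite !size_map size_iota // => i ltir.
  rewrite -map_comp (nth_map 0) ?size_iota // nth_iota //= vz.
  by rewrite addnC addnK.
have initE z r : 0 < size r -> ~~ odd (size r) -> (forall i, v (z i) = r`_(i - 1)) ->
    word_eval v (maelstrom_init z (size r) p) = word_eval id (mael_init p r).
  move=> + evr vz; rewrite -(even_halfK evr); case hr: (_./2) => [//|h] _.
  rewrite maelstrom_initE -hr even_halfK // -[in RHS](vals z r vz).
  by rewrite (mael_init_map v) word_eval_map.
have finalE z r : ~~ odd (size r) -> (forall i, v (z i) = r`_(i - 1)) ->
    word_eval v (maelstrom_final z (size r) q) = word_eval id (mael_final q r).
  move=> evr vz; rewrite -(even_halfK evr) maelstrom_finalE even_halfK //.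
  rewrite -[in RHS](vals z r vz).
  by rewrite (mael_final_map v) word_eval_map.
have cat4 (M : Type) (f : M -> S) a b c d : word_eval f (a ++ (b ++ c) ++ d) =
    word_eval f a * (word_eval f b * word_eval f c) * word_eval f d.
  by rewrite !word_eval_cat !mulgA.
rewrite /maelstrom_insert /maelstrom /mael !{}cat4.
by rewrite (initE X s) // (initE Y t) // (finalE X s) // (finalE Y t).
Qed.

(** Around a cycle split into two arcs [s] and [t], the two linear words differ
    by which of the two junctions they cut. If neither junction matters, both
    words are nestings of the same two maelstrom words, and these commute. *)
Lemma mael_rotate (s t : seq S) :
  ~~ odd (size s) -> ~~ odd (size t) ->
  commute (last 1 s) (head 1 t) -> commute (last 1 t) (head 1 s) ->
  word_eval id (mael p q (s ++ t)) = word_eval id (mael p q (t ++ s)).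
Proof.
move=> evs evt st ts.
have [-> | s0] := eqVneq s [::]; first by rewrite cats0.
have [-> | t0] := eqVneq t [::]; first by rewrite cats0.
by rewrite !(@mael_cat_eval _ 1) // mael_nest_comm.
Qed.

(** The cut made by [rot (uphalf i).*2] lies between an odd position and the
    next even one, one of the two being [i]. *)
Lemma mael_rot_eq1 (s : seq S) (i j : nat) :
  ~~ odd (size s) -> i < size s -> j < size s -> s`_i = 1 -> s`_j = 1 ->
  word_eval id (mael p q (rot (uphalf i).*2 s)) =
  word_eval id (mael p q (rot (uphalf j).*2 s)).
Proof.
move=> evs; wlog le_ij : i j / uphalf i <= uphalf j.
  by move=> IH *; case: (leqP (uphalf i) (uphalf j)) => [|/ltnW] /IH ->.
move=> lti ltj si sj; set c := (uphalf i).*2; set d := (uphalf j).*2.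
have le_cd : c <= d by rewrite leq_double.
have le_ds : d <= size s by lia.
have cE : c = (uphalf i).*2 by [].
have dE : d = (uphalf j).*2 by [].
clearbody c d.
set A := take (d - c) (drop c s); set B := drop d s ++ take c s.
have -> : rot c s = A ++ B.
  rewrite /rot catA; congr (_ ++ _).
  by rewrite -[drop d s](_ : drop (d - c) (drop c s) = _) ?cat_take_drop //
             drop_drop subnK.
have -> : rot d s = B ++ A.
  rewrite /rot -catA; congr (_ ++ _).
  by rewrite /A take_drop subnK // -{1}(take_takel _ le_cd) cat_take_drop.
have szA : size A = d - c by rewrite size_takel // size_drop leq_sub2r.
have szB : size B = size s - (d - c).
  by rewrite size_cat size_drop size_takel ?(leq_trans le_cd) //; lia.
have szD : size (drop d s) = size s - d by rewrite size_drop.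
have d2 : ~~ odd d by rewrite dE odd_double.
have c2 : ~~ odd c by rewrite cE odd_double.
(* The junction from [B] to [A] is the cut next to [i]. *)
have jctBA : last 1 B = 1 \/ head 1 A = 1.
  rewrite -nth_last -nth0 szB nth_cat szD.
  have [oi|ei] := boolP (odd i); [left|right].
    have ic : c = i.+1 by lia.
    rewrite ltnNge ifN ?negbK; last lia.
    have -> : (size s - (d - c)).-1 - (size s - d) = i by lia.
    by rewrite nth_take ?ic.
  have [dc|lt_cd] := leqP d c; first by rewrite nth_default ?szA //; lia.
  rewrite nth_take ?subn_gt0 // nth_drop addn0.
  by have -> : c = i by lia.
(* The junction from [A] to [B] is the cut next to [j]. *)
have jctAB : last 1 A = 1 \/ head 1 B = 1.
  rewrite -nth_last -nth0 szA nth_cat szD.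
  have [oj|ej] := boolP (odd j); [left|right].
    have jd : d = j.+1 by lia.
    have [dc|lt_cd] := leqP d c; first by rewrite nth_default ?szA //; lia.
    rewrite nth_take ?nth_drop; last lia.
    by have -> : c + (d - c).-1 = j by lia.
  have jd : d = j by lia.
  by rewrite jd subn_gt0 ltj nth_drop addn0.
apply: mael_rotate.
- by rewrite szA oddB // (negPf c2) (negPf d2).
- rewrite szB oddB ?oddB // ?(negPf c2) ?(negPf d2) ?(negPf evs) //; lia.
- by case: jctAB => ->; [apply/commute_sym/commute1 | apply: commute1].
- by case: jctBA => ->; [apply/commute_sym/commute1 | apply: commute1].
Qed.
End Rotation.

End Evaluation.

(** * Restriction of a maelstrom word to two letters *)

Section Restriction.

Variables (L : eqType) (a : pred L).

Lemma filter_mael p q (s : seq L) :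
  filter a (mael p q s) = blocks p (filter a (swap_pairs_behead s))
                          ++ blocks q (rev (filter a (swap_pairs s))).
Proof. by rewrite filter_cat !filter_blocks filter_rev. Qed.

Lemma filter_swap_pairs_small (s : seq L) :
  size (filter a s) <= 1 -> filter a (swap_pairs s) = filter a s.
Proof.
by move=> /perm_small_eq; apply; apply: perm_filter; apply: perm_swap_pairs.
Qed.

Lemma filter_swap_pairs_apart (s : seq L) :
  sorted (fun x y => ~~ (a x && a y)) s -> filter a (swap_pairs s) = filter a s.
Proof.
elim/pair_ind: s => // x y s IHs /andP[naxy /path_sorted/IHs /= ->].
by move: naxy; case: (a x); case: (a y).
Qed.

Lemma filter_swap_pairs_behead_apart (s : seq L) :
  sorted (fun x y => ~~ (a x && a y)) s ->
  filter a (swap_pairs_behead s) = filter a s.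
Proof. by case: s => //= x s /path_sorted/filter_swap_pairs_apart ->. Qed.

Lemma filter_swap_pairs_adjacent (s t : seq L) (x y : L) :
  ~~ has a s -> ~~ has a t -> a x -> a y ->
  filter a (swap_pairs (s ++ x :: y :: t)) =
  if odd (size s) then [:: x; y] else [:: y; x].
Proof.
move=> nas nat ax ay; have fat : filter a t = [::].
  by apply/eqP; rewrite -(negbK (_ == _)) -has_filter.
elim/pair_ind: s nas => [_|z|z z' s IHs].
- by rewrite /= ax ay filter_swap_pairs_small fat.
- rewrite /= orbF => /negPf nz; rewrite ax nz; congr (_ :: _).
  by apply: etrans (@filter_swap_pairs_small (y :: t) _) _; rewrite /= ay fat.
- by rewrite /= !negb_or negbK => /and3P[/negPf-> /negPf-> /IHs].
Qed.

Lemma filter_swap_pairs_behead_adjacent (s t : seq L) (x y : L) :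
  ~~ has a s -> ~~ has a t -> a x -> a y ->
  filter a (swap_pairs_behead (s ++ x :: y :: t)) =
  if odd (size s) then [:: y; x] else [:: x; y].
Proof.
case: s => [_|z s] /=.
  move=> nat ax ay; have fat : filter a t = [::].
    by apply/eqP; rewrite -(negbK (_ == _)) -has_filter.
  rewrite ax; congr (_ :: _).
  by apply: etrans (@filter_swap_pairs_small (y :: t) _) _; rewrite /= ay fat.
rewrite negb_or => /andP[/negPf-> nas] nat ax ay.
by rewrite filter_swap_pairs_adjacent // if_neg.
Qed.

End Restriction.

Lemma mael_iota_apart p q n i j : i.+1 < j -> j < n ->
  filter (pred2 i j) (mael p q (iota 0 n)) = blocks p [:: i; j] ++ blocks q [:: j; i].
Proof.
move=> ltij ltjn.
have st : sorted (fun x y => ~~ (pred2 i j x && pred2 i j y)) (iota 0 n).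
  by apply/(sortedP 0) => k; rewrite size_iota => ltk; rewrite !nth_iota //=; lia.
have fE : filter (pred2 i j) (iota 0 n) = [:: i; j].
  apply: (irr_sorted_eq ltn_trans ltnn).
  - exact/(sorted_filter ltn_trans)/iota_ltn_sorted.
  - by rewrite /= andbT ltnW.
  - by move=> k; rewrite mem_filter mem_iota !inE; lia.
by rewrite filter_mael filter_swap_pairs_behead_apart // filter_swap_pairs_apart // fE.
Qed.

Lemma mael_iota_adjacent p q n i : i.+1 < n ->
  let s := if odd i then [:: i.+1; i] else [:: i; i.+1] in
  filter (pred2 i i.+1) (mael p q (iota 0 n)) = blocks p s ++ blocks q s.
Proof.
move=> ltin s; have -> : iota 0 n = iota 0 i ++ [:: i, i.+1 & iota i.+2 (n - i.+2)].
  have {1}-> : n = i + (n - i.+2).+2 by lia.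
  by rewrite iotaD.
rewrite filter_mael.
have nA : ~~ has (pred2 i i.+1) (iota 0 i).
  by apply/hasPn => k; rewrite mem_iota /=; lia.
have nC : ~~ has (pred2 i i.+1) (iota i.+2 (n - i.+2)).
  by apply/hasPn => k; rewrite mem_iota /=; lia.
rewrite filter_swap_pairs_behead_adjacent ?filter_swap_pairs_adjacent //= ?eqxx ?orbT //.
by rewrite size_iota /s; case: ifP.
Qed.

(** The extreme letters cross in the rotated word, where they are neighbours. *)
Lemma mael_iota_wrap p q n : 2 < n -> ~~ odd n ->
  filter (pred2 0 n.-1) (mael p q (rot 2 (iota 0 n))) =
  blocks p [:: 0; n.-1] ++ blocks q [:: 0; n.-1].
Proof.
case: n => [|[|[|n]]] //= _; rewrite !negbK => on.
have -> : rot 2 (iota 0 n.+3) = iota 2 n ++ [:: n.+2; 0; 1].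
  by rewrite -[RHS]cat_rcons -cats1 -(iotaD 2 n 1) addn1.
rewrite filter_mael.
have nA : ~~ has (pred2 0 n.+2) (iota 2 n).
  by apply/hasPn => k; rewrite mem_iota /=; lia.
rewrite filter_swap_pairs_behead_adjacent ?filter_swap_pairs_adjacent //= ?eqxx ?orbT //.
by rewrite size_iota on.
Qed.

(** * Order of letters *)

Lemma index_lt_of_head (L : eqType) (x y : L) (w r : seq L) :
  filter (pred2 x y) w = x :: r -> x != y -> index x w < index y w.
Proof.
move=> + nxy; elim: w => //= z w IHw.
have [->|nzx] := eqVneq z x; first by rewrite (negPf nxy).
by have [->|nzy] := eqVneq z y => //= -[yx]; rewrite yx eqxx in nxy.
Qed.

(** Meant for words in [x] and a single further letter. *)
Definition rename_XY (L : eqType) (x z : L) : letter := if z == x then X 1 else Y 1.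

Lemma index_lt_X (L : eqType) (x y : L) (w : seq L) (r : word) :
  x != y -> map (rename_XY x) (filter (pred2 x y) w) = X 1 :: r ->
  index x w < index y w.
Proof.
move=> nxy; case E : (filter _ w) => [|z t] //= -[+ _]; rewrite /rename_XY.
by case: eqP => // zx _; rewrite {}zx in E; apply: index_lt_of_head E nxy.
Qed.

Lemma index_lt_Y (L : eqType) (x y : L) (w : seq L) (r : word) :
  x != y -> map (rename_XY x) (filter (pred2 x y) w) = Y 1 :: r ->
  index y w < index x w.
Proof.
move=> nxy; case E : (filter _ w) => [|z t] //= -[+ _]; rewrite /rename_XY.
case: eqP => // nzx _; apply: (@index_lt_of_head _ _ _ _ t); last by rewrite eq_sym.
have : z \in filter (pred2 x y) w by rewrite E mem_head.
rewrite mem_filter /= => /andP[/predU1P[//|/eqP zy] _].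
by rewrite zy in E; rewrite -E; apply: eq_filter => k /=; rewrite orbC.
Qed.

(** [F k] and [G k] stand for the positions of the first occurrence of the
    [k]-th letter of the cycle from the left and from the right. A letter [x]
    with minimal [F] is outside its second neighbours. Since [x - 1] ends after
    [x] does, it ends after [x + 2], so it is outside [x + 2], hence starts
    before [x + 1], which crosses [x + 2] and starts after it. By symmetry
    [x + 1] starts before [x - 1], which is absurd. *)
Lemma no_cyclic_nesting (n : nat) (F G : nat -> nat) :
  0 < n -> ~~ odd n ->
  (forall k, F (k + n) = F k) -> (forall k, G (k + n) = G k) ->
  (forall k, ~~ odd k -> F k < F k.+1 /\ G k.+1 < G k) ->
  (forall k, odd k -> F k.+1 < F k /\ G k < G k.+1) ->
  (forall k d, 2 <= d <= 3 ->
     F k < F (k + d) /\ G k < G (k + d) \/ F (k + d) < F k /\ G (k + d) < G k) ->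
  forall x, ~ (forall y, F x <= F y).
Proof.
move=> n_gt0 evn Fn Gn Fev Fodd FG x minx.
(* An odd letter starts after its neighbours. *)
have evx : ~~ odd x by apply/negP => /Fodd[]; have := minx x.+1; lia.
(* A representative of [x - 2] modulo [n]; the letters used are [a], ..., [a + 4]. *)
pose a := x + n * 2 - 2.
have n2 : 2 <= n by case: n n_gt0 evn {Fn Gn a} => [|[]].
have Fa : F a.+2 = F x by rewrite /a (_ : _.+2 = x + n + n) ?Fn //; lia.
have eva : ~~ odd a by rewrite /a; lia.
have minFa y : F a.+2 <= F y by rewrite Fa.
have [/Fev A1 /Fodd A2] : ~~ odd a /\ odd a.+1 by split; rewrite //= ?negbK.
have [/Fev A3 /Fodd A4] : ~~ odd a.+2 /\ odd a.+3 by rewrite /= !negbK.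
have := FG a 2 isT; have := FG a 3 isT; have := FG a.+1 3 isT.
have := FG a.+2 2 isT; rewrite !addSn !addnS !addn0.
have := minFa a; have := minFa a.+4.
lia.
Qed.

(** * Small words *)

Lemma island_nil (S : monoidType) (p q : nat) (x y : letter) : 0 < p ->
  island S [:: nseq p x ++ nseq (p + q) y ++ nseq q x;
               nseq p y ++ nseq (p + q) x ++ nseq q y] ->
  ~ satisfies S [::] (nseq p x ++ nseq (p + q) y ++ nseq q x).
Proof.
set u := nseq p x ++ _; set u' := nseq p y ++ _ => p_gt0 [_ isl] nilu.
have u0 : u ++ u <> [::] by rewrite /u; case: (p) p_gt0.
have /(isl _ u0) [+ _] : u \in [:: u; u'] by rewrite mem_head.
have /[swap]/[apply] : satisfies S u (u ++ u).
  by move=> s; rewrite word_eval_cat -nilu /word_eval big_nil mul1g.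
rewrite !inE => /orP[] /eqP /(congr1 size);
  by rewrite size_cat /u /u' !size_cat !size_nseq; lia.
Qed.

Lemma isoterm_nil (S : monoidType) (w : word) :
  w <> [::] -> isoterm S w -> ~ satisfies S [::] w.
Proof.
move=> w0 iso nilw; have w2 : w ++ w <> [::] by case: (w) w0.
have /(iso _ w2)/(congr1 size) : satisfies S (w ++ w) w.
  by move=> s; rewrite word_eval_cat -nilw /word_eval big_nil mul1g.
by rewrite size_cat; case: (w) w0 => //= ? ? _; lia.
Qed.

(** * An operation that is locally a term function *)

Section Scheme.

Variables (S : finMonoidType) (p q : nat).
Hypothesis p_gt0 : 0 < p.
Hypothesis q_gt0 : 0 < q.
Hypothesis maelstrom_comm : forall m n : nat,
  0 < m -> 0 < n -> ~~ odd m -> ~~ odd n ->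
  satisfies S (maelstrom_insert X n p q (maelstrom Y m p q))
              (maelstrom_insert Y m p q (maelstrom X n p q)).
Hypothesis gathers_pq : forall (c : S) (n : nat), 2 * p + 2 * q <= n -> gathers c n.

Variable N : nat.
Hypothesis even_N : ~~ odd N.

(** The letters are placed on a cycle of even length, and the maelstrom word is
    written after cutting that cycle between [i] and one of its neighbours, in
    such a way that the path begins at an even letter. *)
Definition cut_mael (i : 'I_N) : seq 'I_N :=
  mael p q (rot (uphalf i).*2 (enum 'I_N)).

Lemma size_cut_mael (i : 'I_N) : size (cut_mael i) = (p + q) * N.
Proof.
by rewrite -count_predT count_mael count_predT size_rot size_enum_ord.
Qed.

Lemma cut_mael_unit (a : 'I_N -> S) (i k : 'I_N) :
  a i = 1%g -> a k = 1%g -> word_eval a (cut_mael i) = word_eval a (cut_mael k).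
Proof.
have evalE l : word_eval a (cut_mael l) =
    word_eval id (mael p q (rot (uphalf l).*2 (map a (enum 'I_N)))).
  by rewrite -map_rot mael_map word_eval_map.
have nthE (l : 'I_N) : nth 1%g (map a (enum 'I_N)) l = a l.
  rewrite (nth_map l); last by rewrite size_enum_ord ltn_ord.
  by congr (a _); apply: nth_ord_enum.
have szE : size (map a (enum 'I_N)) = N by rewrite size_map size_enum_ord.
by move=> ai ak; rewrite !evalE; apply: mael_rot_eq1; rewrite ?nthE ?szE.
Qed.

Lemma cut_mael_gather (a : 'I_N -> S) (b : pred 'I_N) (c : S) (i i' : 'I_N) :
  (forall l, b l -> a l = c) -> b i -> b i' -> i != i' ->
  forall k, word_eval a (cut_mael k) =
    (c ^+ ((p + q) * #|b|) * word_eval (fun l => if b l then 1 else a l) (cut_mael k))%g.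
Proof.
move=> ab bi bi' nii' k.
have cnt : count b (cut_mael k) = (p + q) * #|b|.
  rewrite count_mael (permP (_ : perm_eq _ (enum 'I_N))) ?perm_rot //.
  by rewrite enumT -size_filter cardE.
have b2 : 1 < #|b| by apply/card_gt1P; exists i, i'.
rewrite (gathers_eval ab) cnt; last by apply: gathers_pq; nia.
congr (_ * _)%g; rewrite word_eval_filter.
by apply: eq_bigr => l _ /=; rewrite if_neg.
Qed.

(** The letters sharing the value [a i] can be gathered and then erased, and
    likewise for [a k]; once [i] and [k] are both erased, the cuts next to them
    no longer matter. *)
Lemma cut_mael_repeat (a : 'I_N -> S) (i i' k k' : 'I_N) :
  i != i' -> a i = a i' -> k != k' -> a k = a k' ->
  word_eval a (cut_mael i) = word_eval a (cut_mael k).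
Proof.
move=> nii' aii' nkk' akk'; pose b c : pred 'I_N := fun l => a l == c.
have bP c l : b c l -> a l = c by move/eqP.
rewrite !(cut_mael_gather (bP (a i)) (i := i) (i' := i')) ?/b -?aii' //.
congr (_ * _)%g; set a' := fun l => _; have a'i : a' i = 1%g by rewrite /a' eqxx.
have [aki | naki] := eqVneq (a k) (a i).
  by apply: cut_mael_unit; rewrite // /a' aki eqxx.
have bP' l : b (a k) l -> a' l = a k.
  by rewrite /b /a' => /eqP ->; rewrite (negPf naki).
rewrite !(cut_mael_gather bP' (i := k) (i' := k')) ?/b -?akk' //.
by congr (_ * _)%g; apply: cut_mael_unit; rewrite ?eqxx ?a'i // if_same.
Qed.

(** By [cut_mael_repeat] the choice of the repeated entry does not matter; the
    value at tuples with distinct entries is arbitrary. *)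
Definition cycle_op (a : N.-tuple S) : S :=
  if [pick i | [exists j, (i != j) && (tnth a i == tnth a j)]] is Some i
  then word_eval (tnth a) (cut_mael i) else 1%g.

Lemma cycle_opE (a : N.-tuple S) (i j : 'I_N) :
  i != j -> tnth a i = tnth a j -> cycle_op a = word_eval (tnth a) (cut_mael i).
Proof.
move=> nij aij; rewrite /cycle_op; case: pickP => [k|/(_ i)/existsP[]].
  by case/existsP=> l /andP[nkl /eqP akl]; apply: cut_mael_repeat nkl akl nij aij.
by exists j; rewrite nij aij eqxx.
Qed.

(** More than [#|R|] tuples of [R] cannot be distinct. If the tuples numbered
    [i] and [j] coincide, then all coordinates are evaluated at arguments whose
    entries [i] and [j] agree, where the operation is one and the same term. *)
Lemma cycle_op_preserves k (R : {set k.-tuple S}) :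
  #|R| < N ->
  (forall f : N.-tuple S -> S, monoid_term_function f -> preserves f R) ->
  preserves cycle_op R.
Proof.
move=> ltRN termR r rR.
have /injectivePn[i [j nij rij]] : ~~ injectiveb r.
  apply: contraL ltRN => /injectiveP rinj; rewrite -leqNgt.
  rewrite -[N]card_ord -(card_imset _ rinj); apply: subset_leq_card.
  by apply/subsetP => _ /imsetP[l _ ->].
have := termR (fun a => word_eval (tnth a) (cut_mael i)) _ r rR.
have -> : [tuple cycle_op [tuple tnth (r i0) j0 | i0 < N] | j0 < k] =
   [tuple word_eval (tnth [tuple tnth (r i0) j0 | i0 < N]) (cut_mael i) | j0 < k].
  apply: eq_from_tnth => l; rewrite !tnth_mktuple.
  by rewrite (@cycle_opE _ i j) // !tnth_mktuple rij.
apply; exists (cut_mael i); split=> // /(congr1 size).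
by rewrite size_cut_mael /=; have := ltn_ord i; nia.
Qed.

(** * The operation is not a term function *)

Section TermFunction.

Hypothesis N_ge6 : 6 <= N.

Hypothesis ppqq_isoterm :
  let x := X 1 in let y := Y 1 in
  isoterm S (nseq p x ++ nseq p y ++ nseq q x ++ nseq q y).
Hypothesis pq_island :
  let x := X 1 in let y := Y 1 in
  island S [:: nseq p x ++ nseq (p + q) y ++ nseq q x;
               nseq p y ++ nseq (p + q) x ++ nseq q y].

Variable w : seq 'I_N.
Hypothesis w_op : forall a : N.-tuple S, cycle_op a = word_eval (tnth a) w.

(** With all letters but [i] and [j] sent to 1, two further letters agree, so
    the operation is given by the word cut next to any of these. *)
Lemma satisfies_restriction (i j l : 'I_N) : l != i -> l != j ->
  satisfies S (map (rename_XY i) (filter (pred2 i j) w))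
              (map (rename_XY i) (filter (pred2 i j) (cut_mael l))).
Proof.
move=> nli nlj s; rewrite !word_eval_map !word_eval_filter.
set b := fun x => _.
have [l' /and3P[nl'i nl'j nll']] : exists l', [&& l' != i, l' != j & l != l'].
  have : 0 < #|[predC [:: i; j; l]]|.
    rewrite -(ltn_add2l #|[:: i; j; l]|) addn0 cardC card_ord.
    exact: leq_ltn_trans (card_size _) (ltn_trans _ N_ge6).
  case/card_gt0P=> l'; rewrite !inE !negb_or => /and3P[? ? ?].
  by exists l'; apply/and3P; rewrite (eq_sym l).
have tE : tnth (mktuple b) =1 b by move=> k; rewrite tnth_mktuple.
have bE u : word_eval b u = word_eval (tnth (mktuple b)) u.
  by apply: eq_bigr => k _; rewrite tE.
rewrite !bE -w_op; apply: (@cycle_opE _ l l') => //.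
by rewrite !tE /b /= (negPf nli) (negPf nlj) (negPf nl'i) (negPf nl'j).
Qed.

Lemma crossing_order (i j l : 'I_N) : i != j -> l != i -> l != j ->
  filter (pred2 i j) (cut_mael l) = blocks p [:: i; j] ++ blocks q [:: i; j] ->
  index i w < index j w /\ index j (rev w) < index i (rev w).
Proof.
move=> nij nli nlj twE; have := satisfies_restriction nli nlj.
have nji : (j == i) = false by rewrite eq_sym (negPf nij).
rewrite {}twE map_cat -!blocks_map /= /rename_XY eqxx nji /blocks /= !cats0 -!catA.
set u := map _ _ => sat.
have u0 : u <> [::].
  move=> u0; rewrite u0 in sat; apply: isoterm_nil ppqq_isoterm sat.
  by rewrite -(prednK p_gt0).
have {sat u0} uE := ppqq_isoterm u0 sat.
have revE : map (rename_XY i) (filter (pred2 i j) (rev w)) = rev u.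
  by rewrite filter_rev map_rev.
split; first by apply: (index_lt_X nij); rewrite -/u uE -{1}(prednK p_gt0).
by apply: (index_lt_Y nij); rewrite revE uE !rev_cat !rev_nseq -{1}(prednK q_gt0).
Qed.

Lemma nesting_order (i j l : 'I_N) : i != j -> l != i -> l != j ->
  filter (pred2 i j) (cut_mael l) = blocks p [:: i; j] ++ blocks q [:: j; i] ->
  index i w < index j w /\ index i (rev w) < index j (rev w) \/
  index j w < index i w /\ index j (rev w) < index i (rev w).
Proof.
move=> nij nli nlj twE; have := satisfies_restriction nli nlj.
have nji : (j == i) = false by rewrite eq_sym (negPf nij).
rewrite {}twE map_cat -!blocks_map /= /rename_XY eqxx nji /blocks /= !cats0 -!catA.
rewrite (catA (nseq p (Y 1))) -nseqD.
set u := map _ _ => sat.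
have u0 : u <> [::] by move=> u0; rewrite u0 in sat; apply: island_nil pq_island sat.
have revE : map (rename_XY i) (filter (pred2 i j) (rev w)) = rev u.
  by rewrite filter_rev map_rev.
have [_ /(_ u u0)/(_ _ (mem_head _ _))[+ _]] := pq_island.
have /[swap]/[apply] := (fun s => esym (sat s)).
rewrite !inE => /orP[] /eqP uE; [left | right]; split.
- by apply: (index_lt_X nij); rewrite -/u uE -{1}(prednK p_gt0).
- by apply: (index_lt_X nij); rewrite revE uE !rev_cat !rev_nseq -{1}(prednK q_gt0).
- by apply: (index_lt_Y nij); rewrite -/u uE -{1}(prednK p_gt0).
- by apply: (index_lt_Y nij); rewrite revE uE !rev_cat !rev_nseq -{1}(prednK q_gt0).
Qed.

Lemma filter_mael_rot (i j : 'I_N) c :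
  map val (filter (pred2 i j) (mael p q (rot c (enum 'I_N)))) =
  filter (pred2 (i : nat) (j : nat)) (mael p q (rot c (iota 0 N))).
Proof. by rewrite -val_enum_ord -map_rot mael_map filter_map. Qed.

(** Cutting next to either extreme letter of the enumeration leaves it as it
    is. *)
Lemma cut_mael_end (i j : 'I_N) : i < j -> ~~ ((i == 0 :> nat) && (j == N.-1 :> nat)) ->
  exists l : 'I_N, [/\ l != i, l != j & cut_mael l = mael p q (rot 0 (enum 'I_N))].
Proof.
move=> ltij nends; have N_gt0 : 0 < N by apply: leq_ltn_trans (ltn_ord i).
have [i0 | i_gt0] := posnP i.
  have ltN : N.-1 < N by rewrite prednK.
  exists (Ordinal ltN); rewrite -!val_eqE /= /cut_mael /=; split; try lia.
  have -> : (uphalf N.-1).*2 = N by lia.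
  by rewrite rot0 rot_oversize // size_enum_ord.
by exists (Ordinal N_gt0); rewrite -!val_eqE /= /cut_mael /=; split=> //; lia.
Qed.

Lemma adjacent_order (i j : 'I_N) : ~~ odd i ->
  [\/ j = i.+1 :> nat, i = j.+1 :> nat | i = 0 :> nat /\ j = N.-1 :> nat] ->
  index i w < index j w /\ index j (rev w) < index i (rev w).
Proof.
move=> evi; have ltj := ltn_ord j; have lti := ltn_ord i.
case=> [ji|ij|[i0 jN]].
- have [|| l [nli nlj twE]] := @cut_mael_end i j; try lia.
  apply: (@crossing_order i j l) => //; first by rewrite -val_eqE /=; lia.
  rewrite twE; apply: (inj_map val_inj).
  rewrite filter_mael_rot ji rot0 mael_iota_adjacent -?ji // (negPf evi).
  by rewrite map_cat -!blocks_map.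
- have [|| l [nlj nli twE]] := @cut_mael_end j i; try lia.
  apply: (@crossing_order i j l) => //; first by rewrite -val_eqE /=; lia.
  rewrite twE; apply: (inj_map val_inj).
  rewrite filter_mael_rot (eq_filter (_ : _ =1 pred2 (j : nat) (i : nat))); last first.
    by move=> k /=; rewrite orbC.
  rewrite ij rot0 mael_iota_adjacent -?ij // (_ : odd j); last by lia.
  by rewrite map_cat -!blocks_map /= ij.
(* The extreme letters are separated by the standard cut; cut next to 1 instead. *)
have lt1 : 1 < N by lia.
apply: (@crossing_order i j (Ordinal lt1)); rewrite -?val_eqE /=; try lia.
apply: (inj_map val_inj); rewrite filter_mael_rot /= i0 jN mael_iota_wrap //; last by lia.
by rewrite map_cat -!blocks_map /= i0 jN.
Qed.

Lemma apart_order (i j : 'I_N) : i.+1 < j ->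
  ~~ ((i == 0 :> nat) && (j == N.-1 :> nat)) ->
  index i w < index j w /\ index i (rev w) < index j (rev w) \/
  index j w < index i w /\ index j (rev w) < index i (rev w).
Proof.
move=> ltij nends.
have [|| l [nli nlj twE]] := @cut_mael_end i j => //; first exact: ltnW.
apply: (@nesting_order i j l) => //; first by rewrite -val_eqE /=; lia.
rewrite twE; apply: (inj_map val_inj); rewrite filter_mael_rot rot0 mael_iota_apart //.
by rewrite map_cat -!blocks_map.
Qed.

(** The first letter of [w] is the one with minimal first occurrence. *)
Lemma cycle_op_not_term : w <> [::] -> False.
Proof.
move=> w0; have N_gt0 : 0 < N by apply: leq_trans N_ge6.
pose z k : 'I_N := Ordinal (ltn_pmod k N_gt0).
have zN k : z (k + N) = z k by apply: val_inj; rewrite /= modnDr.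
have zS k d : d < N -> (z (k + d) = z k + d :> nat) \/ (z (k + d) + N = z k + d).
  move=> ltd; rewrite /= -modnDml; have := ltn_pmod k N_gt0.
  set r := k %% N => ltr; have [lt|le] := ltnP (r + d) N.
    by left; rewrite modn_small.
  by right; rewrite -(subnK le) modnDr modn_small; lia.
have zodd k : odd (z k) = odd k by rewrite /= odd_mod // (negPf even_N).
case Ew : w w0 => [//|x w'] _.
apply: (@no_cyclic_nesting N (fun k => index (z k) w) (fun k => index (z k) (rev w))
  N_gt0 even_N _ _ _ _ _ x).
- by move=> k; rewrite zN.
- by move=> k; rewrite zN.
- move=> k evk; apply: adjacent_order; first by rewrite zodd.
  have [|zE|zE] := zS k 1; first lia.
  + by constructor 1; rewrite -[k.+1]addn1; lia.
  + by have := zodd k; have := ltn_ord (z k); lia.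
- move=> k oddk; apply: adjacent_order; first by rewrite zodd /= oddk.
  have [|zE|zE] := zS k 1; first lia.
  + by constructor 2; rewrite -[k.+1]addn1; lia.
  + by constructor 3; rewrite -[k.+1]addn1; have := ltn_ord (z k); lia.
move=> k d d23; have [|zE|zE] := zS k d; first lia.
- by apply: apart_order; rewrite zE; lia.
- by apply/or_comm/apart_order; have := ltn_ord (z k); lia.
move=> y; rewrite (_ : z x = x) ?Ew /= ?eqxx //.
by apply: val_inj; rewrite /= modn_small.
Qed.
End TermFunction.
End Scheme.

(** * Absence of a finite set of defining relations *)

Theorem theorem4p13 (S : finMonoidType) (p q : nat) (p_gt0 : 0 < p) (q_gt0 : 0 < q)
    (maelstrom_comm : forall m n : nat,
       0 < m -> 0 < n -> ~~ odd m -> ~~ odd n ->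
       satisfies S (maelstrom_insert X n p q (maelstrom Y m p q))
                   (maelstrom_insert Y m p q (maelstrom X n p q)))
    (sat_A : exists alpha beta : nat,
       [/\ 0 < alpha, 0 < beta, alpha <= 2 * p + 2 * q & satisfies_A S alpha beta])
    (ppqq_isoterm :
       let x := X 1 in let y := Y 1 in
       isoterm S (nseq p x ++ nseq p y ++ nseq q x ++ nseq q y))
    (pq_island :
       let x := X 1 in let y := Y 1 in
       island S [:: nseq p x ++ nseq (p + q) y ++ nseq q x;
                    nseq p y ++ nseq (p + q) x ++ nseq q y]) :
  ~ monoid_finitely_related S.
Proof.
case: sat_A => alpha [beta [alpha_gt0 _ le_alpha satA]].
have gathers_pq (c : S) n : 2 * p + 2 * q <= n -> gathers c n.
  move=> /(leq_trans le_alpha) le_n.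
  exact: gathers_leq alpha_gt0 le_n (satisfies_A_gathers satA c).
case=> r [k [R [_ relR]]].
have [m le_m] : exists m, forall i, #|R i| <= m.
  by exists (\max_i #|R i|) => i; apply: leq_bigmax.
(* The combinatorial argument needs six letters. *)
pose N := (m + 3).*2.
have N_ge6 : 6 <= N by rewrite /N; lia.
have evN : ~~ odd N by rewrite odd_double.
have N_gt0 : 0 < N by apply: leq_trans N_ge6.
have [w [w0 w_op]] : monoid_term_function (@cycle_op S p q N).
  apply/(relR N _ N_gt0) => i; apply: cycle_op_preserves => //.
    by apply: leq_ltn_trans (le_m i) _; rewrite /N; lia.
  by move=> f /(relR N f N_gt0)/(_ i).
exact: (@cycle_op_not_term S p q p_gt0 q_gt0 maelstrom_comm gathers_pq N evN
          N_ge6 ppqq_isoterm pq_island w).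
Qed.
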